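(* Let $\{x^k\},\{\lambda^k\},\{w^k\},\{\rho_k\}$ be sequences generated by the augmented Lagrangian method (described in the context). Assume that (i) $F$ is bounded and pseudomonotone, (ii) $\Phi$ is weakly Mosco-continuous, (iii) $G$ is $\mathcal{K}_\infty$-concave with respect to $y$, (iv) the function $(x,y)\mapsto d_{\mathcal{K}}(G(x,y))$ is weakly sequentially lower semicontinuous on $X\times X$, and (v) $x^{k+1}\in C$ and $\varepsilon^{k+1}-\mathcal{L}_{\rho_k}(x^{k+1},w^k)\in\mathcal{N}_C(x^{k+1})$ for all $k$, where $\{\varepsilon^k\}\subseteq X^*$ satisfies $\varepsilon^k\to0$. Let $\bar{x}$ be a weak limit point of $\{x^k\}$. If $\Phi(\bar{x})$ is nonempty, then $\bar{x}$ is feasible, i.e. $\bar{x}\in\Phi(\bar{x})$, and $\bar{x}$ is a solution of the QVI, i.e. $\bar{x}\in\Phi(\bar{x})$ and $\langle F(\bar{x}),d\rangle\ge0$ for all $d\in\mathcal{T}_{\Phi(\bar{x})}(\bar{x})$.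
   Context: Setting. $X,Y$ are real Banach spaces; $C\subseteq X$, $K\subseteq Y$ are nonempty closed convex sets; $F:X\to X^*$; $G:X\times X\to Y$ is Fréchet differentiable with respect to its second argument $y$, with derivative $D_yG(x,y)\in L(X,Y)$; $\Phi(x):=\{y\in C:G(x,y)\in K\}$. $H$ is a real Hilbert space, $i:Y\hookrightarrow H$ is a continuous linear injection with dense range, and $\mathcal{K}\subseteq H$ is a closed convex set with $i^{-1}(\mathcal{K})=K$. Elements of $Y$ are identified with their images in $H$, and $\lambda\in H$ is identified with the element $y\mapsto(\lambda,i(y))_H$ of $Y^*$. $P_{\mathcal{K}}$ and $d_{\mathcal{K}}$ are the projection onto and distance to $\mathcal{K}$ in $H$. $\mathcal{N}_C(x)=\{\psi\in X^*:\langle\psi,s-x\rangle\le0\ \forall s\in C\}$ for $x\in C$. $\mathcal{T}_S(z)=\{d:\exists\,z^k\to z,\ t_k\downarrow0\text{ with }z^k\in S,\ (z^k-z)/t_k\to d\}$ for $z\in S$. (For convex $\Phi(x)$ the QVI is equivalent to $x\in\Phi(x)$, $\langle F(x),y-x\rangle\ge 0$ for all $y\in\Phi(x)$.) Augmented Lagrangian: for $x\in X$, $\lambda\in H$, $\rho>0$, $\mathcal{L}_\rho(x,\lambda):=F(x)+\rho D_yG(x,x)^*[G(x,x)+\lambda/\rho-P_{\mathcal{K}}(G(x,x)+\lambda/\rho)]\in X^*$. Also $V(x,\lambda,\rho):=\|G(x,x)-P_{\mathcal{K}}(G(x,x)+\lambda/\rho)\|_H$. Augmented Lagrangian method. Given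 $(x^0,\lambda^0)\in X\times H$, $\rho_0>0$, $\gamma>1$, $\tau\in(0,1)$ and a bounded set $B\subseteq H$, for $k=0,1,2,\dots$: choose $w^k\in B$; compute $x^{k+1}$ as an inexact solution of the variational inequality $x\in C$, $\langle\mathcal{L}_{\rho_k}(x,w^k),y-x\rangle\ge0$ for all $y\in C$ (the inexactness is that of hypothesis (v)); set $\lambda^{k+1}:=\rho_k[G(x^{k+1},x^{k+1})+w^k/\rho_k-P_{\mathcal{K}}(G(x^{k+1},x^{k+1})+w^k/\rho_k)]$; if $k=0$ or $V(x^{k+1},w^k,\rho_k)\le\tau V(x^k,w^{k-1},\rho_{k-1})$, set $\rho_{k+1}:=\rho_k$, otherwise $\rho_{k+1}:=\gamma\rho_k$. The method is assumed not to terminate, so infinite sequences are generated. Bounded operator: maps bounded sets to bounded sets. Pseudomonotone (Brezis): $T:X\to X^*$ such that, whenever $x^k\rightharpoonup x$ and $\limsup_k\langle T(x^k),x^k-x\rangle\le0$, then $\langle T(x),x-y\rangle\le\liminf_k\langle T(x^k),x^k-y\rangle$ for all $y\in X$. Weak Mosco-continuity of $\Phi$: for every $x\in X$ and $x^k\rightharpoonup x$: (a) for every $y\in\Phi(x)$ there is a sequence $y^k\in\Phi(x^k)$ with $y^k\to y$; (b) whenever $y^k\in\Phi(x^k)$ for all $k$ and $y$ is a weak limit point of $\{y^k\}$, then $y\in\Phi(x)$. A weak limit point is the weak limit of a subsequence. $\mathcal{K}_\infty:=\{h\in H:h+\mathcal{K}\subseteq\mathcal{K}\}$; $G$ is $\mathcal{K}_\infty$-concave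 with respect to $y$ if $G(x,(1-\alpha)y_1+\alpha y_2)-(1-\alpha)G(x,y_1)-\alpha G(x,y_2)\in\mathcal{K}_\infty$ for all $x,y_1,y_2\in X$, $\alpha\in[0,1]$. *)

(* Defs.v *)
From HB Require Import structures.
From mathcomp Require Import all_boot all_order all_algebra.
From mathcomp Require Import lra.
From mathcomp Require Import all_classical all_reals all_analysis.

Set Implicit Arguments.
Unset Strict Implicit.
Unset Printing Implicit Defensive.

Import Order.TTheory GRing.Theory Num.Theory.
Import numFieldNormedType.Exports.

Local Open Scope classical_set_scope.
Local Open Scope ring_scope.

(**md Bounded linear operators, normed by the operator norm. The topological
   dual of `X` is the space of bounded linear operators into `R^o`, and the
   duality pairing `<f, x>` is the application `f x`. *)

Section BoundedOperators.
Variables (R : realType) (V W : normedModType R).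

Definition blin : {pred V -> W} :=
  [pred f | `[< linear f /\ continuous f >]].

Lemma blinP f : reflect (linear f /\ continuous f) (f \in blin).
Proof. exact: asboolP. Qed.

Lemma blin_submod_closed : submod_closed blin.
Proof.
split=> [|a f g /blinP[lf cf] /blinP[lg cg]].
  apply/blinP; split=> [a u v|x] /=; first by rewrite scaler0 addr0.
  exact: cvg_cst.
apply/blinP; split=> [b u v|x].
  rewrite /= !fctE lf lg !scalerDr addrACA; congr (_ + _ + _).
  by rewrite !scalerA mulrC.
by apply: (@cvgD _ _ _ (nbhs x) _ (a *: f) g) (cg x); exact: cvgZl_tmp (cf x).
Qed.

HB.instance Definition _ :=
  GRing.isSubmodClosed.Build R (V -> W) blin blin_submod_closed.

Record bop : Type := Bop { bop_fun :> V -> W ; _ : bop_fun \in blin }.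

HB.instance Definition _ := [isSub for bop_fun].
HB.instance Definition _ := [Choice of bop by <:].
HB.instance Definition _ := [SubChoice_isSubLmodule of bop by <:].

Implicit Types f g : bop.

Lemma bop_linear f : linear f.
Proof. by have /blinP[] := valP f. Qed.

HB.instance Definition _ f :=
  GRing.isLinear.Build R V W *:%R f (bop_linear f).

Lemma bop_continuous f : continuous f.
Proof. by have /blinP[] := valP f. Qed.

Definition opnorm f : R := sup [set `|f x| | x in [set x | `|x| <= 1]].

Let opset_ubound f : has_ubound [set `|f x| | x in [set x | `|x| <= 1]].
Proof.
have /linear_bounded_continuous/bounded_funP/(_ 1)[M fM] :=
  @bop_continuous f.
by exists M => _ [x /= x1 <-]; exact: fM.
Qed.

Lemma opnormP f x : `|f x| <= opnorm f * `|x|.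
Proof.
have [->|x0] := eqVneq x 0; first by rewrite linear0 !normr0 mulr0.
rewrite -ler_pdivrMr ?normr_gt0// mulrC -[X in X * _]gtr0_norm; last first.
  by rewrite invr_gt0 normr_gt0.
rewrite -normrZ -linearZ; apply: ub_le_sup; first exact: opset_ubound.
exists (`|x|^-1 *: x) => //=.
by rewrite normrZ normfV normr_id mulVf// normr_eq0.
Qed.

Lemma opnorm_le f (M : R) :
  (forall x, `|x| <= 1 -> `|f x| <= M) -> opnorm f <= M.
Proof.
move=> fM; apply: ge_sup; last by move=> _ [x /= x1 <-]; exact: fM.
by exists `|f 0|; exists 0 => //=; rewrite normr0.
Qed.

Lemma opnorm_ge0 f : 0 <= opnorm f.
Proof.
apply: ub_le_sup; first exact: opset_ubound.
by exists 0; rewrite /= ?linear0 normr0.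
Qed.

Let opnormD f g : opnorm (f + g) <= opnorm f + opnorm g.
Proof.
apply: opnorm_le => x x1; rewrite (le_trans (ler_normD _ _))// lerD//.
  by rewrite (le_trans (opnormP _ _))// ler_piMr// opnorm_ge0.
by rewrite (le_trans (opnormP _ _))// ler_piMr// opnorm_ge0.
Qed.

Let opnormZ_le (a : R) f : opnorm (a *: f) <= `|a| * opnorm f.
Proof.
apply: opnorm_le => x x1; rewrite [_ x]/(a *: f x) normrZ ler_wpM2l//.
by rewrite (le_trans (opnormP _ _))// ler_piMr// opnorm_ge0.
Qed.

Let opnormZ (a : R) f : opnorm (a *: f) = `|a| * opnorm f.
Proof.
have [->|a0] := eqVneq a 0.
  rewrite normr0 mul0r; apply/eqP; rewrite eq_le opnorm_ge0 andbT.
  by rewrite (le_trans (opnormZ_le _ _))// normr0 mul0r.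
apply/eqP; rewrite eq_le opnormZ_le/= -ler_pdivlMl ?normr_gt0//.
by rewrite -normfV -{1}[f](scalerK a0) opnormZ_le.
Qed.

Let opnorm0_eq0 f : opnorm f = 0 -> f = 0.
Proof.
move=> f0; apply/val_inj/funext => x; apply/eqP; rewrite -normr_le0.
by rewrite (le_trans (opnormP _ _))// f0 mul0r.
Qed.

HB.instance Definition _ :=
  Lmodule_isNormed.Build R bop opnormD opnormZ opnorm0_eq0.

End BoundedOperators.

Notation dual X := (bop X (GRing.regular _)).

Section Adjoint.
Variables (R : realType) (V W : normedModType R).

Lemma adjoint_subproof (A : bop V W) (f : dual W) :
  (f \o A : V -> R^o) \in @blin R V R^o.
Proof.
apply/blinP; split=> [a u v|x] /=; first by rewrite !linearP.
by apply: continuous_comp; exact: bop_continuous.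
Qed.

Definition adjoint (A : bop V W) (f : dual W) : dual V :=
  Bop (adjoint_subproof A f).

End Adjoint.

(**md Real Hilbert spaces: the norm of a complete space is induced by an inner
   product. *)

HB.mixin Record NormedModule_isHilbert (R : realType) H
    & CompleteNormedModule R H := {
  inner : {dot H for (@idfun R)} ;
  inner_norm : forall u : H, inner u u = `|u| ^+ 2
}.

#[short(type="hilbertType")]
HB.structure Definition Hilbert (R : realType) :=
  {H of CompleteNormedModule R H & NormedModule_isHilbert R H}.

Section InnerDual.
Variables (R : realType) (H : hilbertType R).
Implicit Types u v : H.

Lemma inner_sym u v : inner u v = inner v u.
Proof.
by have := @hermitian_subproof R H false idfun inner u v; rewrite expr0 mul1r.
Qed.

Lemma inner_linear u : linear (inner u : H -> R^o).
Proof. by move=> a v w; rewrite linearPr. Qed.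

Lemma inner_le u v : inner u v <= `|u| * `|v|.
Proof.
have : `|u + v| ^+ 2 <= (`|u| + `|v|) ^+ 2.
  by rewrite ler_sqr ?nnegrE ?addr_ge0 ?normr_ge0// ler_normD.
rewrite -inner_norm linearDl !linearDr /= (inner_sym v u) !inner_norm sqrrD.
by lra.
Qed.

Lemma inner_continuous u : continuous (inner u : H -> R^o).
Proof.
pose f : {linear H -> R^o} :=
  HB.pack (inner u : H -> R^o)
    (GRing.isLinear.Build R H R^o *:%R (inner u) (inner_linear u)).
apply: (@bounded_linear_continuous R H R^o f).
apply/bounded_funP => r; exists (`|u| * r) => x xr /=.
rewrite (@le_trans _ _ (`|u| * `|x|))// ?ler_wpM2l//.
rewrite ler_norml inner_le andbT lerNl -linearNr.
by rewrite (le_trans (inner_le _ _))// normrN.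
Qed.

Lemma inner_subproof u : (inner u : H -> R^o) \in @blin R H R^o.
Proof. by apply/blinP; split; [exact: inner_linear|exact: inner_continuous]. Qed.

Definition inner_dual u : dual H := Bop (inner_subproof u).

End InnerDual.

Section BanachNotions.
Variables (R : realType) (V : normedModType R).
Implicit Types (S : set V) (T : V -> dual V) (u : nat -> V) (x y z : V).

Definition weak_cvg u x := forall f : dual V, f (u k) @[k --> \oo] --> f x.

Definition weak_limit_point u x :=
  exists phi : nat -> nat, increasing_seq phi /\ weak_cvg (u \o phi) x.

Definition weak_seq_lsc (g : V -> R) := forall u x, weak_cvg u x ->
  ((g x)%:E <= limn_einf (fun k => (g (u k))%:E))%E.

Definition bounded_operator T :=
  forall A : set V, bounded_set A -> bounded_set (T @` A).

Definition pseudomonotone T := forall u x, weak_cvg u x ->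
  (limn_esup (fun k => (T (u k) (u k - x))%:E) <= 0)%E ->
  forall y, ((T x (x - y))%:E <= limn_einf (fun k => (T (u k) (u k - y))%:E))%E.

Definition normal_cone S x : set (dual V) :=
  [set psi | forall s, S s -> psi (s - x) <= 0].

Definition tangent_cone S x : set V :=
  [set d | exists z : nat -> V, exists t : nat -> R,
    [/\ z @ \oo --> x, forall k, 0 < t k, t @ \oo --> 0,
        forall k, S (z k) & (t k)^-1 *: (z k - x) @[k --> \oo] --> d]].

Definition distance S x : R := inf [set `|x - s| | s in S].

(* The metric projection; meaningful only when a nearest point exists. *)
Definition projection S x : V :=
  get [set p | S p /\ forall s, S s -> `|x - p| <= `|x - s|].

Definition recession_cone S : set V :=
  [set h | forall s, S s -> S (h + s)].

Definition weakly_mosco_continuous (Phi : V -> set V) :=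
  forall x u, weak_cvg u x ->
  (forall y, Phi x y ->
     exists2 v : nat -> V, forall k, Phi (u k) (v k) & v @ \oo --> y) /\
  (forall (v : nat -> V) y,
     (forall k, Phi (u k) (v k)) -> weak_limit_point v y -> Phi x y).

End BanachNotions.

Section QVI.
Variables (R : realType) (X Y : completeNormedModType R) (H : hilbertType R).
Variables (C : set X) (K : set Y) (KH : set H) (i : bop Y H).
Variables (F : X -> dual X) (G : X -> X -> Y) (DyG : X -> X -> bop X Y).
Implicit Types (x y : X) (lambda : H) (rho : R).

Definition feasible_map x : set X := [set y | C y /\ K (G x y)].

Definition qvi_solution x :=
  feasible_map x x /\ forall d, tangent_cone (feasible_map x) x d -> 0 <= F x d.

Definition concave_wrt_recession :=
  forall x y1 y2 (a : R), 0 <= a <= 1 ->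
  recession_cone KH (i (G x ((1 - a) *: y1 + a *: y2)
    - (1 - a) *: G x y1 - a *: G x y2)).

Definition shifted_constraint x lambda rho : H :=
  i (G x x) + rho^-1 *: lambda.

Definition multiplier_update x lambda rho : H :=
  rho *: (shifted_constraint x lambda rho
          - projection KH (shifted_constraint x lambda rho)).

(* `adjoint i (inner_dual h)` is `h` viewed as the functional
   `y |-> inner h (i y)` on `Y`. *)
Definition augmented_lagrangian x lambda rho : dual X :=
  F x + rho *: adjoint (DyG x x) (adjoint i (inner_dual
    (shifted_constraint x lambda rho
     - projection KH (shifted_constraint x lambda rho)))).

Definition progress_measure x lambda rho : R :=
  `|i (G x x) - projection KH (shifted_constraint x lambda rho)|.

(* The inexact solution of the variational inequality for `x k.+1` is not part
   of the record: it is what the inexactness criterion below prescribes. *)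
Record alm_sequences (gamma tau : R) (B : set H)
    (x : nat -> X) (lambda w : nat -> H) (rho : nat -> R) : Prop :=
  AlmSequences {
    alm_rho0_gt0 : 0 < rho 0%N ;
    alm_gamma_gt1 : 1 < gamma ;
    alm_tau_itv : 0 < tau < 1 ;
    alm_B_bounded : bounded_set B ;
    alm_w : forall k, B (w k) ;
    alm_lambda : forall k,
      lambda k.+1 = multiplier_update (x k.+1) (w k) (rho k) ;
    alm_rho : forall k, rho k.+1 =
      if (k == 0%N) || (progress_measure (x k.+1) (w k) (rho k) <=
                        tau * progress_measure (x k) (w k.-1) (rho k.-1))
      then rho k else gamma * rho k
  }.

Definition inexact_vi_steps (x : nat -> X) (w : nat -> H) (rho : nat -> R)
    (eps : nat -> dual X) : Prop :=
  forall k, C (x k.+1) /\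
    normal_cone C (x k.+1)
      (eps k.+1 - augmented_lagrangian (x k.+1) (w k) (rho k)).

End QVI.

(* Main.v *)
Require Import Defs.
From HB Require Import structures.
From mathcomp Require Import all_boot all_order all_algebra.
From mathcomp Require Import lra ring.
From mathcomp Require Import all_classical all_reals all_analysis.

(** Write [u = x k.+1], [w = w k], [rho = rho k], and let [q] be the residual
    [i (G u u) - P (i (G u u) + w / rho)], whose norm drives the penalty update.
    Everything rests on one inequality ([alm_step_estimate]): for every [s]
    feasible for [u],
      [rho * `|q| ^+ 2 + inner w q <= F u (s - u) - e (s - u)],
    where [e] is the inexactness. It combines the inexact variational inequality,
    the gradient inequality supplied by the concavity of [G], and the variational
    inequality of the projection.

    Let [u] run through a weakly convergent subsequence with limit [xbar]. The
    points [u] are bounded by the uniform boundedness principle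
    ([weak_cvg_bounded]), hence so are the functionals [F u], and Mosco-continuity
    provides feasible [s] converging to any prescribed point of [Phi xbar]. The
    residuals tend to 0 ([residual_cvg0]): either the progress test eventually
    always succeeds and they decay geometrically, or [rho] tends to infinity
    ([penalty_dichotomy]) and the inequality above, whose right-hand side is
    bounded, forces [q] to 0. As [`|q|] dominates the distance of [i (G u u)] to
    [KH], lower semicontinuity of this distance and weak closedness of [C] make
    [xbar] feasible.

    Next, the left-hand side of the inequality is at least [inner w q], which
    tends to 0, so for each [y] in [Phi xbar] the pairings [F u (u - y)] are
    bounded above by a null sequence ([pairing_asymptotic_bound]). Taking
    [y = xbar], pseudomonotonicity applies, and its conclusion gives
    [0 <= F xbar (y - xbar)] for every [y] in [Phi xbar]. The inequality passes to
    tangent directions by continuity.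

    Weak closedness of closed convex sets and boundedness of weakly convergent
    sequences depend on the Hahn-Banach theorem, proved here for sublinear
    functionals above a convex cone ([Hahn_Banach_sandwich]). *)

Set Implicit Arguments.
Unset Strict Implicit.

Import Order.TTheory GRing.Theory Num.Theory.
Import numFieldNormedType.Exports.

Local Open Scope classical_set_scope.
Local Open Scope ring_scope.

(** * The Hahn-Banach theorem in sandwich form *)

Section HahnBanach.
Context {R : realType} {V : lmodType R}.
Implicit Types (p q : V -> R) (M : set (V * R^o)) (x y : V) (a : R).

(** Homogeneity is asked as an inequality for positive factors only: applied to
   the inverse factor it gives equality, and with subadditivity it forces the
   value 0 at the origin. *)
Definition sublinear p :=
  (forall x y, p (x + y) <= p x + p y) /\
  (forall a x, 0 < a -> p (a *: x) <= a * p x).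

Lemma sublinear0 p : sublinear p -> p 0 = 0.
Proof.
move=> [pD pZ]; have := pD 0 0; have := pZ 2^-1 0 ltac:(lra).
by rewrite addr0 scaler0; lra.
Qed.

Lemma sublinearN_ge p x : sublinear p -> - p (- x) <= p x.
Proof.
by move=> ps; have := ps.1 x (- x); rewrite subrr (sublinear0 ps); lra.
Qed.

(** Oddness turns the subadditivity inequality at [- x, - y] into the reverse
   of the one at [x, y]. *)
Lemma sublinear_odd_linear p :
  sublinear p -> (forall x, p (- x) <= - p x) -> linear (p : V -> R^o).
Proof.
move=> ps p_odd; have [pD pZ] := ps.
have pN x : p (- x) = - p x.
  by have := sublinearN_ge x ps; have := p_odd x; lra.
have pZpos a x : 0 < a -> p (a *: x) = a * p x.
  move=> a0; apply/eqP; rewrite eq_le pZ//= -ler_pdivlMl//.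
  rewrite (le_trans _ (pZ _ _ _)) ?invr_gt0//.
  by rewrite scalerA mulVf ?scale1r// gt_eqF.
have pDE x y : p (x + y) = p x + p y.
  have := pD (- x) (- y); rewrite -opprD !pN => h.
  by have := pD x y; lra.
move=> a x y; rewrite pDE; congr (_ + _).
have [a0|a0|->] := ltgtP a 0; last by rewrite !scale0r (sublinear0 ps).
- rewrite -[a]opprK scaleNr pN pZpos ?oppr_gt0//.
  by rewrite scaleNr.
- exact: pZpos.
Qed.

(** Cones live in [V * R]: a point [(v, s)] encodes the demand that a
   functional take at least the value [s] at [v]. *)
Definition convex_cone M :=
  [/\ M 0, forall m n, M m -> M n -> M (m + n) &
      forall a m, 0 < a -> M m -> M (a *: m)].

Definition below_graph M q := forall m, M m -> m.2 <= q m.1.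

(** The largest sublinear functional [r <= q] with [r (- v) <= - s] for all
   [(v, s)] in [M]. A linear functional below it satisfies the demands of [M],
   since its value at [- v] is the opposite of its value at [v]. *)
Definition shrink M q x := inf [set q (x + m.1) - m.2 | m in M].

Section Shrink.
Variables (M : set (V * R^o)) (q : V -> R).
Hypotheses (coneM : convex_cone M) (qs : sublinear q) (Mq : below_graph M q).

Let shrink_lb x : lbound [set q (x + m.1) - m.2 | m in M] (- q (- x)).
Proof.
move=> _ [m Mm <-]; have := qs.1 (x + m.1) (- x).
by rewrite addrC addKr; have := Mq Mm; lra.
Qed.

Let shrink_nonempty x : [set q (x + m.1) - m.2 | m in M] !=set0.
Proof. by have [M0 _ _] := coneM; exists (q (x + 0) - 0), 0. Qed.

Lemma shrink_le_at m x : M m -> shrink M q x <= q (x + m.1) - m.2.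
Proof.
by move=> Mm; apply: ge_inf; [exists (- q (- x)); exact: shrink_lb | exists m].
Qed.

Lemma le_shrink x b : (forall m, M m -> b <= q (x + m.1) - m.2) ->
  b <= shrink M q x.
Proof. by move=> h; apply: lb_le_inf => // _ [m Mm <-]; exact: h. Qed.

Lemma shrink_le x : shrink M q x <= q x.
Proof.
have [M0 _ _] := coneM.
by rewrite (le_trans (shrink_le_at _ M0))//= addr0 subr0.
Qed.

Lemma shrinkN_le m : M m -> shrink M q (- m.1) <= - m.2.
Proof.
by move=> /(shrink_le_at (- m.1)); rewrite addNr (sublinear0 qs) sub0r.
Qed.

Lemma shrink_sublinear : sublinear (shrink M q).
Proof.
have [_ MD MZ] := coneM; split=> [x y|a x a0].
  (* Sums of two elements of [M] are admissible in the infimum at [x + y]. *)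
  suff h m : M m -> shrink M q (x + y) - shrink M q y <= q (x + m.1) - m.2.
    by rewrite -lerBlDr; apply: le_shrink.
  move=> Mm; rewrite lerBlDr -lerBlDl; apply: le_shrink => n Mn.
  have := shrink_le_at (x + y) (MD _ _ Mm Mn).
  rewrite /= addrACA; have := qs.1 (x + m.1) (y + n.1); lra.
rewrite -ler_pdivrMl//; apply: le_shrink => m Mm.
rewrite ler_pdivrMl//; apply: le_trans (shrink_le_at _ (MZ _ _ a0 Mm)) _.
by rewrite /= -scalerDr mulrBr lerB// qs.2.
Qed.

End Shrink.

(** Zorn's lemma for the reverse pointwise order. The infimum of a chain is
   finite because every sublinear [q <= p] satisfies [- p (- x) <= q x], and it
   is subadditive because two members of a chain can be replaced by the smaller
   one. *)
Lemma exists_minimal_sublinear p : sublinear p ->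
  exists q, [/\ sublinear q, forall x, q x <= p x &
    forall r, sublinear r -> (forall x, r x <= q x) -> r = q].
Proof.
move=> ps; pose T := {q : V -> R | sublinear q /\ forall x, q x <= p x}.
pose Rel : rel T := fun s t => `[< forall x, sval t x <= sval s x >].
have bnd (q : T) x : - p (- x) <= sval q x.
  case: q => q [qs qp] /=; have := sublinearN_ge x qs.
  by have := qp (- x); lra.
have [||||q qmin] := @Zorn T Rel.
- by move=> q; apply/asboolP.
- move=> q r s /asboolP rq /asboolP sr; apply/asboolP => x.
  exact: le_trans (sr x) (rq x).
- move=> [q qP] [r rP] /asboolP rq /asboolP qr; apply: eq_exist => /=.
  by apply/funext => x; apply/eqP; rewrite eq_le rq qr.
- move=> A Atot; have [[q0 Aq0]|A0] := pselect (A !=set0); last first.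
    exists (exist _ p (conj ps (fun x => lexx (p x)))) => s As.
    by case: A0; exists s.
  pose g x := inf [set sval s x | s in A].
  have gle (q : T) x : A q -> g x <= sval q x.
    by move=> Aq; apply: ge_inf; [exists (- p (- x)) => _ [r _ <-]|exists q].
  have leg b x : (forall q : T, A q -> b <= sval q x) -> b <= g x.
    move=> h; apply: lb_le_inf => [|_ [q Aq <-]]; last exact: h.
    by exists (sval q0 x); exists q0.
  have gs : sublinear g.
    split=> [x y|a x a0].
      rewrite -lerBlDr; apply: (leg) => q1 Aq1.
      rewrite lerBlDr -lerBlDl; apply: (leg) => q2 Aq2.
      rewrite lerBlDl.
      have [q [Aq qq1 qq2]] : exists q : T, [/\ A q, sval q x <= sval q1 x
          & sval q y <= sval q2 y].
        have [/asboolP h|/asboolP h] := Atot _ _ Aq1 Aq2.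
          by exists q2; split.
        by exists q1; split.
      apply: le_trans (gle _ _ Aq) _.
      by apply: le_trans ((svalP q).1.1 x y) _; exact: lerD.
    rewrite -ler_pdivrMl//; apply: (leg) => q Aq; rewrite ler_pdivrMl//.
    exact: le_trans (gle _ _ Aq) ((svalP q).1.2 _ _ a0).
  have gp x : g x <= p x by exact: le_trans (gle _ _ Aq0) ((svalP q0).2 x).
  by exists (exist _ g (conj gs gp)) => s As; apply/asboolP => x; exact: gle.
exists (sval q); have [qs qp] := svalP q; split=> // r rs rq.
have rp x : r x <= p x := le_trans (rq x) (qp x).
rewrite -(qmin (exist _ r (conj rs rp)))//.
exact/asboolP.
Qed.

(** Minimal sublinear functionals are linear: shrinking a minimal [f] along
   the ray of [(y, f y)] cannot change it, hence [f (- y) <= - f y]. It thus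
   suffices to take a minimal functional below [shrink M p]. Taking
   for [M] a ray gives norming functionals; a cone over a convex set gives
   separation. *)
Theorem Hahn_Banach_sandwich M p : convex_cone M -> sublinear p ->
    below_graph M p ->
  exists f : V -> R, [/\ linear (f : V -> R^o), forall x, f x <= p x &
    forall m, M m -> m.2 <= f m.1].
Proof.
move=> coneM ps Mp.
have [f [fs fp fmin]] := exists_minimal_sublinear (shrink_sublinear coneM ps Mp).
exists f; split.
- apply: sublinear_odd_linear => // y.
  pose N : set (V * R^o) := [set m | exists2 t : R, 0 <= t & m = t *: (y, f y)].
  have coneN : convex_cone N.
    split=> [|_ _ [s s0 ->] [t t0 ->]|a _ a0 [t t0 ->]].
    + by exists 0; rewrite ?scale0r.
    + by exists (s + t); rewrite ?addr_ge0// scalerDl.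
    + by exists (a * t); rewrite ?scalerA// mulr_ge0// ltW.
  have Nf : below_graph N f.
    move=> _ [t t0 ->] /=; move: t0; rewrite le_eqVlt => /predU1P[<-|t0].
      by rewrite !scale0r (sublinear0 fs).
    rewrite -[_ *: _]/(t * f y) mulrC -ler_pdivlMr//.
    have := fs.2 t^-1 (t *: y); rewrite invr_gt0 scalerA mulVf ?gt_eqF//.
    by rewrite scale1r mulrC; exact.
  rewrite -[X in X <= _](_ : shrink N f (- y) = f (- y)).
    by apply: (shrinkN_le fs Nf (m := (y, f y))); exists 1; rewrite ?scale1r.
  congr (_ _); apply: fmin; first exact: shrink_sublinear.
  exact: shrink_le.
- by move=> x; exact: le_trans (fp x) (shrink_le coneM ps Mp x).
- move=> m Mm; have := sublinearN_ge (- m.1) fs; rewrite opprK.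
  have := fp (- m.1); have := shrinkN_le ps Mp Mm; lra.
Qed.

End HahnBanach.

(** * Bounded operators, dual functionals and weak convergence *)

Section BoundedOperatorTheory.
Context {R : realType} {V W : normedModType R}.

Lemma bounded_linear_blin (f : V -> W) (M : R) :
  linear f -> (forall x, `|f x| <= M * `|x|) -> f \in @blin R V W.
Proof.
move=> lf fM; apply/blinP; split=> //.
pose g : {linear V -> W} :=
  HB.pack f (GRing.isLinear.Build R V W *:%R f lf).
apply: (@bounded_linear_continuous R V W g); apply/bounded_funP => r.
exists (`|M| * r) => x xr /=; apply: le_trans (fM x) _.
apply: le_trans (ler_wpM2r (normr_ge0 _) (ler_norm M)) _.
exact: ler_wpM2l.
Qed.

Lemma bopE_sub (f g : bop V W) x : (f - g) x = f x - g x.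
Proof. by []. Qed.

Lemma bopE_add (f g : bop V W) x : (f + g) x = f x + g x.
Proof. by []. Qed.

Lemma bopE_scale (f : bop V W) (a : R) x : (a *: f) x = a *: f x.
Proof. by []. Qed.

Lemma bopB (f : bop V W) x y : f (x - y) = f x - f y.
Proof. exact: linearB. Qed.

Lemma bopZ (f : bop V W) (a : R) x : f (a *: x) = a *: f x.
Proof. exact: linearZ. Qed.

Lemma bop_cvg (f : bop V W) (u : nat -> V) x :
  u @ \oo --> x -> f (u k) @[k --> \oo] --> f x.
Proof. by move=> ux; apply: cvg_comp ux _; exact: bop_continuous. Qed.

End BoundedOperatorTheory.

Section DualFunctionals.
Context {R : realType} {X : normedModType R}.
Implicit Types (x y : X) (u : nat -> X) (C : set X).

Lemma dual_of_dominated (f : X -> R) :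
  linear (f : X -> R^o) -> (forall x, f x <= `|x|) ->
  exists2 g : dual X, (g : X -> R) = f & forall x, `|g x| <= `|x|.
Proof.
move=> lf f1.
have fN x : f (- x) = - f x.
  by have := lf (-1) x 0; have := lf 1 0 0; rewrite !scale1r !addr0 scaleN1r
     -[_ *: _]/(-1 * f x); lra.
have f1' x : `|f x| <= `|x|.
  by rewrite ler_norml f1 andbT lerNl -fN -normrN.
have fB : (f : X -> R^o) \in @blin R X R^o.
  by apply: (@bounded_linear_blin _ _ _ _ 1) => // x; rewrite mul1r.
by exists (Bop fB).
Qed.

Lemma norm_sublinear : sublinear (fun x => `|x|).
Proof.
by split=> [x y|a x a0]; [exact: ler_normD | rewrite normrZ gtr0_norm].
Qed.

(** The cone is the ray of [(x, `|x|)], on which the norm is attained. *)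
Lemma norming_functional x :
  exists2 f : dual X, f x = `|x| & forall y, `|f y| <= `|y|.
Proof.
pose M : set (X * R^o) := [set m | exists2 t : R, 0 <= t & m = t *: (x, `|x|)].
have coneM : convex_cone M.
  split=> [|_ _ [s s0 ->] [t t0 ->]|a _ a0 [t t0 ->]].
  - by exists 0; rewrite ?scale0r.
  - by exists (s + t); rewrite ?addr_ge0// scalerDl.
  - by exists (a * t); rewrite ?scalerA// mulr_ge0// ltW.
have M_le : below_graph M (fun x => `|x|).
  by move=> _ [t t0 ->] /=; rewrite normrZ ger0_norm.
have [f [lf fle fM]] := Hahn_Banach_sandwich coneM norm_sublinear M_le.
have [g gf gle] := dual_of_dominated lf fle.
exists g => //; apply/eqP; rewrite eq_le gf fle.
by apply: (fM (x, `|x|)); exists 1; rewrite ?scale1r.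
Qed.

Lemma convex_set_comb C x y (a : R) : @convex_set R X C -> C x -> C y ->
  0 <= a <= 1 -> C (a *: x + (1 - a) *: y).
Proof.
move=> cC Cx Cy /andP[a0 a1].
by have /set_mem := cC x y (Itv01 a0 a1) (mem_set Cx) (mem_set Cy).
Qed.

Lemma closed_gap C x : closed C -> ~ C x ->
  exists2 e : R, 0 < e & forall c, C c -> e <= `|x - c|.
Proof.
move=> clC nCx.
have /nbhs_ballP[e e0 eC] : nbhs x (~` C).
  by apply: open_nbhs_nbhs; split=> //; exact: closed_openC.
exists e => // c Cc; rewrite leNgt; apply/negP => xce.
by apply: (eC c _ Cc); rewrite -ball_normE.
Qed.

(** If [x] were at distance at least [e > 0] from [C], the cone generated by
   the points [(x - c, e)] would lie below the norm, so some functional would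
   separate [x] from every [c] in [C] by at least [e]. *)
Lemma closed_convex_weakly_closed C u x : closed C -> @convex_set R X C ->
  (forall k, C (u k)) -> weak_cvg u x -> C x.
Proof.
move=> clC cvC Cu ux; apply: contrapT => /(closed_gap clC)[e e0 eC].
pose M : set (X * R^o) :=
  [set m | exists2 t : R, 0 <= t & exists2 c, C c & m = t *: (x - c, e)].
have coneM : convex_cone M.
  split=> [|_ _ [s s0 [c Cc ->]] [t t0 [d Cd ->]]|a _ a0 [t t0 [c Cc ->]]].
  - by exists 0 => //; exists (u 0%N); rewrite ?scale0r.
  - have [st0|st0] := eqVneq (s + t) 0.
      have [-> ->] : s = 0 /\ t = 0 by split; lra.
      by exists 0 => //; exists c; rewrite ?scale0r ?addr0.
    have st_gt0 : 0 < s + t by rewrite lt_neqAle eq_sym st0 addr_ge0.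
    exists (s + t); first exact: ltW.
    exists ((s / (s + t)) *: c + (1 - s / (s + t)) *: d).
      apply: convex_set_comb => //; rewrite divr_ge0 ?(ltW st_gt0)//=.
      by rewrite ler_pdivrMr// mul1r lerDl.
    have -> : 1 - s / (s + t) = t / (s + t) by field.
    congr (_, _) => /=; last by rewrite -scalerDl.
    rewrite 3!scalerBr scalerDr !scalerA.
    rewrite [_ * (s / _)]mulrC [_ * (t / _)]mulrC !divfK//.
    by rewrite scalerDl opprD addrACA.
  - by exists (a * t); rewrite ?mulr_ge0 ?(ltW a0)//; exists c; rewrite ?scalerA.
have M_le : below_graph M (fun x => `|x|).
  move=> _ [t t0 [c Cc ->]] /=; rewrite normrZ ger0_norm//.
  by rewrite -[_ *: _]/(t * e) ler_wpM2l// eC.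
have [f [lf fle fM]] := Hahn_Banach_sandwich coneM norm_sublinear M_le.
have [g gf _] := dual_of_dominated lf fle.
have g_gap k : g (u k) <= g x - e.
  have : e <= f (x - u k).
    apply: (fM (x - u k, e)); exists 1 => //.
    by exists (u k); rewrite ?scale1r.
  by rewrite -gf linearB/=; lra.
have : g x <= g x - e.
  apply: (@cvgr_to_le _ _ _ _ _ _ _ (ux g)).
  by apply: nearW => k; exact: g_gap.
by lra.
Qed.

End DualFunctionals.

Section BoundedOperatorsComplete.
Context {R : realType} {V : normedModType R} {W : completeNormedModType R}.

Lemma opnorm_le_ratio (f : bop V W) (M : R) :
  0 <= M -> (forall x, `|f x| <= M * `|x|) -> opnorm f <= M.
Proof.
move=> M0 fM; apply: opnorm_le => x x1.
by rewrite (le_trans (fM x))// ler_piMr.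
Qed.

(** The limit is built pointwise; the bound on [f x - L x] obtained from one
   ball of the filter gives both the boundedness of [L] and the convergence in
   operator norm. *)
Lemma bop_complete (F : set_system (bop V W)) :
  ProperFilter F -> cauchy F -> cvg F.
Proof.
move=> FF /cauchyP Fc.
pose ev x (f : bop V W) := f x.
have ev_le x (f g : bop V W) : `|ev x f - ev x g| <= `|f - g| * `|x|.
  by rewrite /ev -bopE_sub; exact: opnormP.
have evc x : cvg (ev x @ F).
  apply: cauchy_cvg; apply: cauchy_exP => e e0.
  have e'0 : 0 < e / (`|x| + 1) by rewrite divr_gt0// ltr_pwDr.
  have [f Ff] := Fc _ e'0; exists (f x).
  change (F (ev x @^-1` ball (f x) e)).
  apply: filterS Ff => g; rewrite -!ball_normE /= => fg.
  apply: (le_lt_trans (ev_le x f g)).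
  apply: (@le_lt_trans _ _ (e / (`|x| + 1) * `|x|)).
    by rewrite ler_wpM2r// ltW.
  by rewrite mulrAC ltr_pdivrMr ?ltr_pwDr// ltr_pM2l// ltrDl.
pose L x : W := lim (ev x @ F).
have evL x : ev x @ F --> L x := evc x.
have L_near f e x : F (ball f e) -> `|f x - L x| <= e * `|x|.
  move=> Ff; have : `|ev x f - ev x g| @[g --> F] --> `|f x - L x|.
    by apply: cvg_norm; apply: cvgB; [exact: cvg_cst | exact: evL].
  move=> /cvgr_to_le; apply; apply: filterS Ff => g.
  rewrite -ball_normE /= => fg; apply: (le_trans (ev_le x f g)).
  by rewrite ler_wpM2r// ltW.
have L_linear : linear L.
  move=> a x y; have := evL (a *: x + y).
  have -> : ev (a *: x + y) = (fun f => a *: ev x f + ev y f).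
    by apply/funext => f; rewrite /ev linearP.
  move=> h; apply: (cvg_unique _ h) => //.
  by apply: cvgD; [apply: cvgZl_tmp; exact: evL|exact: evL].
have [f1 Ff1] := Fc 1 ltr01.
have LB : L \in @blin R V W.
  apply: (@bounded_linear_blin _ _ _ _ (opnorm f1 + 1)) => // x.
  rewrite mulrDl -[L x](subKr (f1 x)).
  apply: le_trans (ler_normB _ _) _; apply: lerD; first exact: opnormP.
  exact: L_near.
apply/cvg_ex; exists (Bop LB); apply/cvgrPdist_lt => e e0.
have e20 : 0 < e / 2 by lra.
have [f Ff] := Fc _ e20.
near=> g.
have : `|f - g| < e / 2.
  by near: g; apply: filterS Ff => g; rewrite -ball_normE.
have : `|Bop LB - f| <= e / 2.
  apply: opnorm_le_ratio; first exact: ltW.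
  by move=> x; rewrite bopE_sub /= distrC; exact: L_near.
have := ler_distD f (Bop LB) g; lra.
Unshelve. all: by end_near. Qed.

HB.instance Definition _ :=
  Uniform_isComplete.Build (bop V W) bop_complete.

End BoundedOperatorsComplete.

Section WeakConvergence.
Context {R : realType} {X : normedModType R}.
Implicit Types (u : nat -> X) (x : X).

(** The points of the sequence act on the Banach space [dual X] by evaluation
   and are pointwise bounded there, so the uniform boundedness principle applies;
   norming functionals convert the bound on evaluations into one on norms. *)
Lemma weak_cvg_bounded u x : weak_cvg u x -> exists M, forall k, `|u k| <= M.
Proof.
move=> ux.
pose ev k (f : dual X) : R^o := f (u k).
have [|f|M evM] := @Banach_Steinhauss R (dual X) R^o (range ev) _ _ 1.
- move=> _ [k _ <-]; split=> // r; exists (r * `|u k|) => f fr.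
  by apply: le_trans (opnormP f (u k)) _; rewrite ler_wpM2r.
- have [M [Mreal fM]] := cvg_seq_bounded (cvgP _ (ux f)).
  exists (M + 1) => _ [k _ <-]; apply: (fM (M + 1)) => //.
  by rewrite ltrDl.
exists M => k; have [f fuk f1] := norming_functional (u k).
rewrite -fuk; apply: le_trans (ler_norm _) _.
apply: (evM (ev k)) => //; apply: opnorm_le => y y1.
exact: le_trans (f1 y) y1.
Qed.

End WeakConvergence.

(** * Projection onto closed convex sets of a Hilbert space *)

Section HilbertProjection.
Context {R : realType} {H : hilbertType R}.
Implicit Types (u v z p s : H) (S : set H) (a : R).

Lemma innerDr u v z : inner u (v + z) = inner u v + inner u z.
Proof. by have := inner_linear u 1 v z; rewrite !scale1r. Qed.

Lemma inner0r u : inner u 0 = 0 :> R.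
Proof. by have := innerDr u 0 0; rewrite addr0; lra. Qed.

Lemma innerZr a u v : inner u (a *: v) = a * inner u v.
Proof. by have := inner_linear u a v 0; rewrite !addr0 inner0r addr0. Qed.

Lemma innerNr u v : inner u (- v) = - inner u v.
Proof. by rewrite -scaleN1r innerZr mulN1r. Qed.

Lemma innerBr u v z : inner u (v - z) = inner u v - inner u z.
Proof. by rewrite innerDr innerNr. Qed.

Lemma innerDl u v z : inner (u + v) z = inner u z + inner v z.
Proof. by rewrite inner_sym innerDr !(inner_sym z). Qed.

Lemma innerZl a u v : inner (a *: u) v = a * inner u v.
Proof. by rewrite inner_sym innerZr inner_sym. Qed.

Lemma innerNl u v : inner (- u) v = - inner u v.
Proof. by rewrite inner_sym innerNr inner_sym. Qed.

Lemma innerBl u v z : inner (u - v) z = inner u z - inner v z.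
Proof. by rewrite innerDl innerNl. Qed.

Lemma normB_sq u v : `|u - v| ^+ 2 = `|u| ^+ 2 - 2 * inner u v + `|v| ^+ 2.
Proof.
rewrite -!inner_norm innerBl !innerBr (inner_sym v u).
by ring.
Qed.

(** The parallelogram law for the sides [z - u] and [z - v]. The midpoint is
   written as a convex combination so that convexity applies to it directly. *)
Lemma midpoint_sq z u v :
  `|u - v| ^+ 2 = 2 * `|z - u| ^+ 2 + 2 * `|z - v| ^+ 2
    - 4 * `|z - (2^-1 *: u + (1 - 2^-1) *: v)| ^+ 2.
Proof.
rewrite !normB_sq -[`|_ + _| ^+ 2]inner_norm.
rewrite !(innerDr, innerDl, innerZr, innerZl).
by rewrite !inner_norm (inner_sym v u); field.
Qed.

(** Minimizing sequences for the squared distance are Cauchy by the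
   parallelogram law, since midpoints stay in [S]. *)
Lemma projection_exists S z : closed S -> @convex_set R H S -> S !=set0 ->
  exists p, S p /\ forall s, S s -> `|z - p| <= `|z - s|.
Proof.
move=> clS cvS [s0 Ss0].
pose A := [set `|z - s| ^+ 2 | s in S]; pose D := inf A.
have lbA : has_lbound A by exists 0 => _ [s _ <-]; exact: sqr_ge0.
have infA : has_inf A by split=> //; exists (`|z - s0| ^+ 2), s0.
have D_le s : S s -> D <= `|z - s| ^+ 2.
  by move=> Ss; apply: ge_inf => //; exists s.
have near_inf (n : nat) : exists s, S s /\ `|z - s| ^+ 2 < D + n.+1%:R^-1.
  have [|_ [s Ss <-] sD] := @inf_adherent _ A n.+1%:R^-1 _ infA.
    by rewrite invr_gt0 ltr0n.
  by exists s.
have [f fP] := choice near_inf.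
have fcauchy n m : (n <= m)%N -> `|f n - f m| ^+ 2 < 4 / n.+1%:R.
  move=> nm; have [Sn nD] := fP n; have [Sm mD] := fP m.
  rewrite (midpoint_sq z).
  have := D_le _ (@convex_set_comb _ _ _ _ _ 2^-1 cvS Sn Sm ltac:(lra)).
  have : m.+1%:R^-1 <= n.+1%:R^-1 :> R by rewrite lef_pV2 ?posrE ?ltr0n// ler_nat.
  move: nD mD; move: (n.+1%:R^-1) (m.+1%:R^-1) => en em nD mD mn midD.
  by lra.
have inv_small (e : R) : 0 < e -> exists n : nat, n.+1%:R^-1 < e.
  move=> e0; near \oo => n; exists n; near: n.
  exact: near_infty_natSinv_lt (PosNum e0).
have fcvg : cvg (f @ \oo).
  apply: cauchy_cvg; apply: cauchy_exP => e e0.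
  have [n ne] := inv_small (e ^+ 2 / 4) ltac:(by rewrite divr_gt0// exprn_gt0).
  exists (f n); change (\forall m \near \oo, ball (f n) e (f m)).
  near=> m; rewrite -ball_normE /=.
  rewrite -(ltr_pXn2r (n := 2))// ?nnegrE ?(ltW e0)//.
  apply: lt_trans (fcauchy n m _) _; last by rewrite mulrC -ltr_pdivlMr.
  by near: m; exact: nbhs_infty_ge.
pose p : H := lim (f @ \oo).
have fp : f @ \oo --> p := fcvg.
have Sp : S p.
  by apply: (closed_cvg _ clS _ _ fp); apply: nearW => n; exact: (fP n).1.
exists p; split=> // s Ss.
rewrite -(ler_pXn2r (n := 2))// ?nnegrE//; apply: le_trans (D_le s Ss).
apply/ler_addgt0Pr => e e0; have [n ne] := inv_small e e0.
have : `|z - f k| ^+ 2 @[k --> \oo] --> `|z - p| ^+ 2.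
  have h : `|z - f k| @[k --> \oo] --> `|z - p|.
    by apply: cvg_norm; apply: cvgB => //; exact: cvg_cst.
  by apply: cvgM.
move=> /cvgr_to_le; apply; near=> m.
have [_ mD] := fP m; apply/ltW/(lt_le_trans mD); rewrite lerD2l.
apply: le_trans (ltW ne); rewrite lef_pV2 ?posrE ?ltr0n// ler_nat ltnS.
by near: m; exact: nbhs_infty_ge.
Unshelve. all: by end_near. Qed.

Lemma projectionP S z : closed S -> @convex_set R H S -> S !=set0 ->
  S (projection S z) /\ forall s, S s -> `|z - projection S z| <= `|z - s|.
Proof. by move=> clS cvS /(projection_exists z clS cvS)/getPex. Qed.

(** Moving from the projection towards [s] by a fraction [t] cannot decrease
   the distance, which gives [2 t a <= t ^+ 2 b] with [a] the inner product in
   question and [b] the squared length of the displacement. *)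
Lemma projection_variational S z s : closed S -> @convex_set R H S -> S s ->
  inner (z - projection S z) (s - projection S z) <= 0.
Proof.
move=> clS cvS Ss; have [Sp pmin] := projectionP z clS cvS (ex_intro _ s Ss).
set p := projection S z in Sp pmin *; set a := inner _ _.
pose b := `|s - p| ^+ 2; have b0 : 0 <= b := sqr_ge0 _.
have key t : 0 <= t <= 1 -> 2 * (a * t) <= t ^+ 2 * b.
  move=> t01.
  have : `|z - p| ^+ 2 <= `|z - (t *: s + (1 - t) *: p)| ^+ 2.
    rewrite ler_pXn2r ?nnegrE//; by apply: pmin; exact: convex_set_comb.
  have -> : z - (t *: s + (1 - t) *: p) = (z - p) - t *: (s - p).
    rewrite scalerBl scale1r scalerBr.
    by rewrite !opprD !opprK !addrA; congr (_ + _); rewrite addrAC.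
  rewrite (normB_sq (z - p)) normrZ innerZr exprMn -/a -/b.
  by rewrite real_normK ?num_real// [t * a]mulrC; lra.
rewrite leNgt; apply/negP => a0.
have ab : 0 < a + b by lra.
(* With this [t], [t * b < a], which contradicts [2 t a <= t ^+ 2 b]. *)
pose t := a / (a + b).
have t0 : 0 < t by rewrite divr_gt0.
have t1 : t <= 1 by rewrite ler_pdivrMr// mul1r lerDl.
have tab : t * (a + b) = a by rewrite divfK// gt_eqF.
have := key t ltac:(by rewrite (ltW t0)).
have -> : t ^+ 2 * b = t * a - t ^+ 2 * a by rewrite -[in t * a]tab; ring.
have : 0 < a * t by rewrite mulr_gt0.
have : 0 < t ^+ 2 * a by rewrite mulr_gt0// exprn_gt0.
by lra.
Qed.

End HilbertProjection.

(** * Real sequences *)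

Section RealSequences.
Context {R : realType}.
Implicit Types (u v b : nat -> R) (l : R).

Lemma limn_esup_le_cvg_bound u b l : (forall k, u k <= b k) ->
  b @ \oo --> l -> (limn_esup (fun k => (u k)%:E) <= l%:E)%E.
Proof.
move=> ub bl; apply/lee_addgt0Pr => e e0.
have bl_e : \forall k \near \oo, b k < l + e.
  by apply: (cvgr_lt _ bl); rewrite ltrDl.
apply: (@le_trans _ _ (ereal_sup [set (u k)%:E | k in [set k | b k < l + e]])).
  by apply: ereal_inf_lbound; exists [set k | b k < l + e].
apply: ge_ereal_sup => _ [k /= bk <-].
by rewrite -EFinD lee_fin (le_trans (ub k))// ltW.
Qed.

Lemma le_limn_einf_le l' u b l : (forall k, u k <= b k) -> b @ \oo --> l ->
  (l'%:E <= limn_einf (fun k => (u k)%:E))%E -> l' <= l.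
Proof.
move=> ub bl /le_trans/(_ (limn_einf_sup _)).
by move=> /le_trans/(_ (limn_esup_le_cvg_bound ub bl)); rewrite lee_fin.
Qed.

Lemma contraction_cvg0 v (tau : R) (N : nat) : 0 < tau < 1 ->
  (forall k, 0 <= v k) -> (forall k, (N <= k)%N -> v k.+1 <= tau * v k) ->
  v @ \oo --> 0.
Proof.
move=> /andP[tau0 tau1] v0 vtau.
rewrite -(cvg_shiftn N).
have vgeo n : v (n + N)%N <= v N * tau ^+ n.
  elim: n => [|n IHn]; first by rewrite expr0 mulr1.
  rewrite addSn exprS (le_trans (vtau _ (leq_addl _ _)))//.
  by rewrite mulrCA ler_wpM2l// ltW.
apply: (@squeeze_cvgr _ _ _ _ (fun=> 0) (geometric (v N) tau)).
- by apply: nearW => n; rewrite v0 vgeo.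
- exact: cvg_cst.
- by apply: cvg_geometric; rewrite gtr0_norm.
Qed.

(** Either the progress test succeeds from some index on, and [v] decays
   geometrically, or it fails infinitely often, and each failure adds at least
   [(gamma - 1) * rho 0] to the nondecreasing [rho]. *)
Lemma penalty_dichotomy (v rho : nat -> R) (tau gamma : R) :
  0 < tau < 1 -> 1 < gamma -> (forall k, 0 <= v k) -> 0 < rho 0%N ->
  rho 1%N = rho 0%N ->
  (forall k, rho k.+2 =
     if v k.+1 <= tau * v k then rho k.+1 else gamma * rho k.+1) ->
  (forall k, rho 0%N <= rho k) /\ (v @ \oo --> 0 \/ rho @ \oo --> +oo).
Proof.
move=> tau01 gamma1 v0 rho0 rho1 rhoS.
have step k : rho 0%N <= rho k -> rho k <= rho k.+1.
  case: k => [_|k rk]; first by rewrite rho1.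
  rewrite rhoS; case: ifP => // _.
  by rewrite ler_peMl// ltW// (lt_le_trans rho0).
have ge0 k : rho 0%N <= rho k.
  by elim: k => // k IHk; exact: le_trans IHk (step _ IHk).
have mono n m : (n <= m)%N -> rho n <= rho m.
  by move: n m; apply/nondecreasing_seqP => k; exact: step.
split=> //.
have [[N vN]|noN] := pselect (exists N, forall k, (N <= k)%N -> v k.+1 <= tau * v k).
  by left; exact: contraction_cvg0 vN.
right; have inc N : exists2 k, (N <= k)%N & ~~ (v k.+1 <= tau * v k).
  apply: contrapT => h; apply: noN; exists N => k Nk.
  by apply: contrapT => /negP nv; apply: h; exists k.
pose d := (gamma - 1) * rho 0%N.
have d0 : 0 < d by rewrite mulr_gt0// subr_gt0.
have unb m : exists k, m%:R * d <= rho k.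
  elim: m => [|m [k IHm]]; first by exists 0%N; rewrite mul0r ltW.
  have [j kj /negbTE nv] := inc k; exists j.+2; rewrite rhoS nv -natr1 mulrDl mul1r.
  rewrite -[gamma](subrK 1) mulrDl mul1r addrC lerD//.
    by rewrite ler_wpM2l// subr_ge0 ltW.
  by apply: le_trans IHm _; apply: mono; exact: leqW.
apply/cvgryPge => A; have [k Ak] := unb (Num.truncn (A / d)).+1.
near=> n; apply: (@le_trans _ _ (rho k)).
  apply: le_trans Ak; rewrite -ler_pdivrMr// ltW//.
  exact: Num.Theory.truncnS_gt.
by apply: mono; near: n; exact: nbhs_infty_ge.
Unshelve. all: by end_near. Qed.

(** Where [e <= a k], the left-hand side is at least [rho k * e * a k], whereas
   the right-hand side is at most [(`|M| + `|M'| / e) * a k]; this is impossible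
   once [rho k] is large. *)
Lemma growing_quadratic_cvg0 (rho a : nat -> R) (M M' : R) :
  (forall k, 0 <= a k) -> rho @ \oo --> +oo ->
  (forall k, rho k * a k ^+ 2 <= M' + M * a k) -> a @ \oo --> 0.
Proof.
move=> a0 rhoy rhoa; apply/cvgr0Pnorm_lt => e e0.
near=> k.
have rk : `|M| + `|M'| / e < rho k * e.
  by rewrite -ltr_pdivrMr//; near: k; exact: (cvgryPgt _).1 rhoy _.
rewrite ger0_norm// ltNge; apply/negP => ae.
have h : (`|M| + `|M'| / e) * a k < rho k * a k ^+ 2.
  rewrite expr2 mulrA; rewrite ltr_pM2r ?(lt_le_trans e0)//.
  apply: (lt_le_trans rk); rewrite ler_wpM2l//.
  rewrite leNgt; apply/negP => r0.
  have : rho k * e < 0 by rewrite nmulr_rlt0.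
  by apply/negP; rewrite -leNgt (le_trans _ (ltW rk))// addr_ge0// divr_ge0// ltW.
have h1 : M * a k <= `|M| * a k by rewrite ler_wpM2r// ler_norm.
have h2 : M' <= `|M'| / e * a k.
  apply: le_trans (ler_norm M') _.
  by rewrite mulrAC ler_pdivlMr// ler_wpM2l.
have := rhoa k; lra.
Unshelve. all: by end_near. Qed.

End RealSequences.

(** * One step of the augmented Lagrangian method *)

Section AugmentedLagrangianStep.
Context {R : realType} {X Y : completeNormedModType R} {H : hilbertType R}.
Variables (C : set X) (K : set Y) (KH : set H) (i : bop Y H).
Variables (F : X -> dual X) (G : X -> X -> Y) (DyG : X -> X -> bop X Y).
Implicit Types (u s : X) (w r : H) (rho : R).

Lemma diff_quotient_cvg (g : X -> Y) (D : bop X Y) y v : is_diff y g D ->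
  h^-1 *: (g (h *: v + y) - g y) @[h --> 0^'+] --> D v.
Proof.
move=> gD; have dg := @ex_diff _ _ _ _ _ _ _ gD.
have := @diff_derivable R X Y g y v dg.
rewrite /derivable => /cvg_dnbhs_at_right.
have -> : D v = 'D_v g y by rewrite deriveE// (@diff_val _ _ _ _ _ _ _ gD).
exact.
Qed.

(** For a functional [r] that is nonpositive on the recession cone, the map
   [y |-> inner r (i (G u y))] is convex, because the concavity defect of [G]
   lies in that cone; the claim is the gradient inequality for it. *)
Lemma concave_derivative_le u s r : is_diff u (G u) (DyG u u) ->
  concave_wrt_recession KH i G ->
  (forall h, recession_cone KH h -> inner r h <= 0) ->
  inner r (i (DyG u u (s - u))) <= inner r (i (G u s)) - inner r (i (G u u)).
Proof.
move=> GD Gconc rpolar.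
have quot : inner r (i (h^-1 *: (G u (h *: (s - u) + u) - G u u))) @[h --> 0^'+]
    --> inner r (i (DyG u u (s - u))).
  apply: cvg_comp; last exact: (@inner_continuous R H r).
  apply: cvg_comp; last exact: (@bop_continuous R Y H i).
  exact: diff_quotient_cvg.
apply: (cvgr_to_le quot); near=> h.
have h0 : 0 < h by near: h; exact: nbhs_right_gt.
have h1 : h <= 1 by near: h; exact: nbhs_right_le.
have := rpolar _ (Gconc u u s h ltac:(by rewrite (ltW h0) h1)).
have -> : (1 - h) *: u + h *: s = h *: (s - u) + u.
  by rewrite scalerBl scale1r scalerBr addrAC [RHS]addrC addrA addrAC.
rewrite !(bopZ, bopB) !(innerBr, innerZr, bopB).
rewrite ler_pdivrMl//; lra.
Unshelve. all: by end_near. Qed.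

(** Its norm is [progress_measure]. *)
Definition residual u w rho : H :=
  i (G u u) - projection KH (shifted_constraint i G u w rho).

(** With [z] the shifted constraint, [r = z - P z] and [q] the residual, one
   has [r = q + w / rho]. The vector [r] is normal to [KH] at [P z], hence
   nonpositive on the recession cone, so the gradient inequality and the
   variational inequality for [P z] against the point [i (G u s)] of [KH] bound
   the penalty term of the Lagrangian at [s - u] by
   [- rho * inner r q = - (rho * `|q| ^+ 2 + inner w q)]. *)
Lemma alm_step_estimate u w s rho (e : dual X) :
  closed KH -> @convex_set R H KH -> i @^-1` KH = K ->
  is_diff u (G u) (DyG u u) -> concave_wrt_recession KH i G -> 0 < rho ->
  normal_cone C u (e - augmented_lagrangian KH i F G DyG u w rho) ->
  feasible_map C K G u s ->
  rho * `|residual u w rho| ^+ 2 + inner w (residual u w rho)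
    <= F u (s - u) - e (s - u).
Proof.
move=> clK cvK iK GD Gconc rho0 nrm [Cs Ks].
have KGs : KH (i (G u s)) by rewrite -iK in Ks.
rewrite /residual; set z := shifted_constraint i G u w rho.
set q := _ - _; pose r := z - projection KH z.
have rq : r = q + rho^-1 *: w by rewrite /r /q /z /shifted_constraint addrAC.
have [Pz _] := projectionP z clK cvK (ex_intro _ _ KGs).
have rpolar h : recession_cone KH h -> inner r h <= 0.
  move=> /(_ _ Pz) /(projection_variational z clK cvK).
  by rewrite addrK.
have lin := concave_derivative_le s GD Gconc rpolar.
have var := projection_variational z clK cvK KGs.
have := nrm s Cs.
rewrite /augmented_lagrangian bopE_sub bopE_add bopE_scale /=.
rewrite -/z -/r -[_ *: inner _ _]/(rho * inner r (i (DyG u u (s - u)))) => ineq.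
have : inner r (i (G u s)) - inner r (i (G u u)) <= - inner r q.
  move: var; rewrite -/r /q !innerBr; lra.
have rq_inner : inner r q = `|q| ^+ 2 + rho^-1 * inner w q.
  by rewrite rq (innerDl q) innerZl inner_norm.
rewrite rq_inner => rr.
have : rho * inner r (i (DyG u u (s - u))) <=
    - (rho * `|q| ^+ 2 + inner w q).
  have -> : - (rho * `|q| ^+ 2 + inner w q) =
      rho * - (`|q| ^+ 2 + rho^-1 * inner w q) by field; rewrite gt_eqF.
  by rewrite ler_pM2l//; apply: le_trans lin rr.
lra.
Qed.

End AugmentedLagrangianStep.

(** * Weak limits of the iterates *)

Section Bounds.
Context {R : realType} {V : normedModType R}.

Lemma cvg_norm_bounded (a : nat -> V) (l : V) :
  a @ \oo --> l -> exists M, forall k, `|a k| <= M.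
Proof.
move=> /cvgP/cvg_seq_bounded[M [Mreal aM]].
by exists (M + 1) => k; apply: (aM (M + 1)) => //; rewrite ltrDl.
Qed.

Lemma dual_le (f : dual V) (v : V) (M N : R) :
  opnorm f <= M -> `|v| <= N -> f v <= M * N.
Proof.
move=> fM vN; rewrite (le_trans (ler_norm _))// (le_trans (opnormP f v))//.
by rewrite ler_pM// opnorm_ge0.
Qed.

Lemma weak_cvg_diag (u : nat -> V) (x : V) :
  weak_cvg u x -> weak_cvg (fun k => (u k, u k)) (x, x).
Proof.
move=> ux f.
have fdiag : (fun v => f (v, v) : R^o) \in @blin R V R^o.
  apply/blinP; split=> [a v v'|v].
    by have := @bop_linear _ _ _ f a (v, v) (v', v').
  apply: (@continuous_comp _ _ _ (fun v : V => (v, v)) f);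
    last exact: bop_continuous.
  by apply: cvg_pair; exact: cvg_id.
exact: (ux (Bop fdiag)).
Qed.

Lemma mem_of_distance_le0 (S : set V) (v : V) :
  closed S -> S !=set0 -> distance S v <= 0 -> S v.
Proof.
move=> clS [s0 Ss0] d0; apply: contrapT => /(closed_gap clS)[e e0 eS].
suff : e <= distance S v by lra.
by apply: lb_le_inf => [|_ [s Ss <-]]; [exists `|v - s0|, s0 | exact: eS].
Qed.

(** Difference quotients [(z - x) / t] of points of [S] are positive multiples
   of admissible directions, and the half-space [0 <= f] is closed. *)
Lemma variational_tangent (f : dual V) (S : set V) (x : V) :
  (forall y, S y -> 0 <= f (y - x)) ->
  forall d, tangent_cone S x d -> 0 <= f d.
Proof.
move=> fS d [z [t [_ t0 _ Sz zd]]].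
have fzd : (f ((t k)^-1 *: (z k - x)) : R) @[k --> \oo] --> (f d : R).
  exact: bop_cvg zd.
apply: (cvgr_to_ge fzd); apply: nearW => k.
by rewrite linearZ /= -[_ *: _]/(_ * _) mulr_ge0 ?fS// invr_ge0 ltW.
Qed.

End Bounds.

Section LimitPoint.
Context {R : realType} {X Y : completeNormedModType R} {H : hilbertType R}.
Variables (C : set X) (K : set Y) (KH : set H) (i : bop Y H).
Variables (F : X -> dual X) (G : X -> X -> Y) (DyG : X -> X -> bop X Y).
Hypotheses (C_closed : closed C) (C_convex : @convex_set R X C).
Hypotheses (KH_closed : closed KH) (KH_convex : @convex_set R H KH).
Hypothesis preimage_KH : i @^-1` KH = K.
Hypothesis G_diff : forall x y : X, is_diff y (G x) (DyG x y).
Hypothesis F_bounded : bounded_operator F.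
Hypothesis F_pseudomonotone : pseudomonotone F.
Hypothesis Phi_mosco : weakly_mosco_continuous (feasible_map C K G).
Hypothesis G_concave : concave_wrt_recession KH i G.
Hypothesis dist_lsc : weak_seq_lsc
     (fun p : (X * X)%type => distance KH (i (G p.1 p.2))).
Variables (u : nat -> X) (w : nat -> H) (rho : nat -> R) (e : nat -> dual X).
Variables (xbar : X) (Mw : R).
Hypothesis u_in_C : forall k, C (u k).
Hypothesis u_step : forall k, normal_cone C (u k)
  (e k - augmented_lagrangian KH i F G DyG (u k) (w k) (rho k)).
Hypothesis rho_gt0 : forall k, 0 < rho k.
Hypothesis w_bounded : forall k, `|w k| <= Mw.
Hypothesis e_cvg0 : e @ \oo --> 0.
Hypothesis u_weak : weak_cvg u xbar.
Let Phi := feasible_map C K G.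
Let q k := residual KH i G (u k) (w k) (rho k).
Hypothesis residual_or_penalty :
  (fun k => `|q k|) @ \oo --> 0 \/ rho @ \oo --> +oo.
Hypothesis Phi_xbar_neq0 : Phi xbar !=set0.

Let estimate k s : Phi (u k) s ->
  rho k * `|q k| ^+ 2 + inner (w k) (q k) <= F (u k) (s - u k) - e k (s - u k).
Proof. by move=> ?; exact: (alm_step_estimate (C := C) (K := K)). Qed.

Let F_u_bounded : exists M, forall k, opnorm (F (u k)) <= M.
Proof.
have [Mu uM] := weak_cvg_bounded u_weak.
have [M [Mreal FM]] : bounded_set (F @` [set y | `|y| <= Mu]).
  apply: F_bounded; exists Mu; split; first exact: num_real.
  by move=> M MuM y /= yMu; rewrite (le_trans yMu)// ltW.
exists (M + 1) => k; apply: (FM (M + 1)); first by rewrite ltrDl.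
by exists (u k) => //=.
Qed.

Let w_q_ge k : - (Mw * `|q k|) <= inner (w k) (q k).
Proof.
rewrite lerNl -innerNr (le_trans (inner_le _ _))// normrN.
by rewrite ler_wpM2r.
Qed.

(** When the penalty blows up, the step estimate is applied to points
   [s k] of [Phi (u k)] that converge to a point of [Phi xbar]. All quantities
   except [rho] being bounded, it reads [rho k * `|q k| ^+ 2 <= M' + M * `|q k|]. *)
Lemma residual_cvg0 : (fun k => `|q k|) @ \oo --> 0.
Proof.
case: residual_or_penalty => // rhoy.
have [y Phiy] := Phi_xbar_neq0.
have [s Phis sy] := (Phi_mosco u_weak).1 y Phiy.
have [Ms sM] := cvg_norm_bounded sy.
have [Mu uM] := weak_cvg_bounded u_weak.
have [MF FM] := F_u_bounded.
have [Me eM] := cvg_norm_bounded e_cvg0.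
apply: (growing_quadratic_cvg0 (M := Mw) (M' := (MF + Me) * (Ms + Mu))) rhoy _.
  by move=> k.
move=> k; have := estimate (Phis k).
have su : `|s k - u k| <= Ms + Mu by rewrite (le_trans (ler_normB _ _))// lerD.
have Fsu := dual_le (FM k) su.
have : - e k (s k - u k) <= Me * (Ms + Mu).
  rewrite -linearN; apply: dual_le; first exact: eM.
  by rewrite normrN.
have := w_q_ge k; lra.
Qed.

(** The step estimate bounds [F (u k) (u k - s k)] from above for any
   [s k] in [Phi (u k)] converging to [y]; as the residuals vanish and [F (u k)]
   is bounded, replacing [s k] by [y] costs a null sequence. *)
Lemma pairing_asymptotic_bound y : Phi xbar y ->
  exists2 b : nat -> R, b @ \oo --> 0 & forall k, F (u k) (u k - y) <= b k.
Proof.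
move=> Phiy; have [s Phis sy] := (Phi_mosco u_weak).1 y Phiy.
have [Ms sM] := cvg_norm_bounded sy.
have [Mu uM] := weak_cvg_bounded u_weak.
have [MF FM] := F_u_bounded.
exists (fun k => Mw * `|q k| + `|e k| * (Ms + Mu) + MF * `|s k - y|).
  have -> : (0 : R) = Mw * 0 + `|0 : dual X| * (Ms + Mu) + MF * `|y - y|.
    by rewrite subrr !normr0 !mulr0 mul0r !addr0.
  apply: cvgD; first apply: cvgD.
  - by apply: cvgM; [exact: cvg_cst | exact: residual_cvg0].
  - by apply: cvgM; [exact: cvg_norm | exact: cvg_cst].
  - apply: cvgM; first exact: cvg_cst.
    by apply: cvg_norm; apply: cvgB => //; exact: cvg_cst.
move=> k; have -> : u k - y = (s k - y) - (s k - u k).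
  by rewrite opprB [RHS]addrC addrA subrK.
rewrite linearB /=.
have su : `|s k - u k| <= Ms + Mu by rewrite (le_trans (ler_normB _ _))// lerD.
have Fsy : F (u k) (s k - y) <= MF * `|s k - y| by exact: dual_le.
have : - e k (s k - u k) <= `|e k| * (Ms + Mu).
  by rewrite -linearN; apply: dual_le; rewrite ?normrN.
have rq : 0 <= rho k * `|q k| ^+ 2 by rewrite mulr_ge0 ?sqr_ge0// ltW.
have := w_q_ge k; have := estimate (Phis k); lra.
Qed.

(** The distance of [i (G (u k) (u k))] to [KH] is at most the norm of the
   residual, hence tends to 0, and lower semicontinuity passes this to the
   limit. *)
Lemma limit_point_feasible : Phi xbar xbar.
Proof.
have [y [_ Ky]] := Phi_xbar_neq0.
have KHy : KH (i (G xbar y)) by rewrite -preimage_KH in Ky.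
have KH0 : KH !=set0 by exists (i (G xbar y)).
split; first exact: closed_convex_weakly_closed u_weak.
rewrite -preimage_KH; apply: (mem_of_distance_le0 KH_closed KH0).
apply: (le_limn_einf_le _ residual_cvg0 (dist_lsc (weak_cvg_diag u_weak))).
move=> k /=; apply: ge_inf; first by exists 0 => _ [h _ <-].
exists (projection KH (shifted_constraint i G (u k) (w k) (rho k))) => //.
by have [] := projectionP (shifted_constraint i G (u k) (w k) (rho k))
  KH_closed KH_convex KH0.
Qed.

(** The asymptotic bound at [y = xbar], available because [xbar] is feasible,
   is the premise of pseudomonotonicity; at [y] it makes the resulting lower
   limit nonpositive. *)
Lemma limit_point_variational y : Phi xbar y -> 0 <= F xbar (y - xbar).
Proof.
move=> Phiy.
have [b b0 Fb] := pairing_asymptotic_bound limit_point_feasible.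
have [c c0 Fc] := pairing_asymptotic_bound Phiy.
have := F_pseudomonotone u_weak (limn_esup_le_cvg_bound Fb b0) y.
by move=> /(le_limn_einf_le Fc c0) Fle; rewrite -opprB linearN oppr_ge0.
Qed.

Lemma limit_point_solution : qvi_solution C K F G xbar.
Proof.
split; first exact: limit_point_feasible.
exact/variational_tangent/limit_point_variational.
Qed.

End LimitPoint.

(** * The method along a weakly convergent subsequence *)

Lemma increasing_seq_ge (phi : nat -> nat) :
  increasing_seq phi -> forall k, (k <= phi k)%N.
Proof.
move=> phi_inc; elim=> // k IHk; apply: leq_ltn_trans IHk _.
by rewrite ltnNge; have := phi_inc k.+1 k; rewrite !leEnat ltnn => ->.
Qed.

Lemma alm_residual_or_penalty (R : realType) (X Y : completeNormedModType R)
    (H : hilbertType R) (KH : set H) (i : bop Y H) (G : X -> X -> Y)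
    (gamma tau : R) (B : set H) (x : nat -> X) (lambda w : nat -> H)
    (rho : nat -> R) : alm_sequences KH i G gamma tau B x lambda w rho ->
  (forall k, 0 < rho k) /\
  ((fun k => `|residual KH i G (x k.+1) (w k) (rho k)|) @ \oo --> 0 \/
   rho @ \oo --> +oo).
Proof.
case=> rho0 gamma1 tau01 _ _ _ rhoS.
have [||||rho_ge cvg_or] := @penalty_dichotomy R
  (fun k => `|residual KH i G (x k.+1) (w k) (rho k)|) rho tau gamma tau01 gamma1.
- by [].
- exact: rho0.
- by rewrite rhoS.
- by move=> k; rewrite rhoS.
by split=> // k; exact: lt_le_trans (rho_ge k).
Qed.

Unset Implicit Arguments.
Set Strict Implicit.

Theorem theorem6p3
  (R : realType) (X Y : completeNormedModType R) (H : hilbertType R)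
  (C : set X) (K : set Y) (KH : set H) (i : bop Y H)
  (F : X -> dual X) (G : X -> X -> Y) (DyG : X -> X -> bop X Y)
  (C_neq0 : C !=set0) (C_closed : closed C)
  (C_convex : @convex_set R X C)
  (K_neq0 : K !=set0) (K_closed : closed K)
  (K_convex : @convex_set R Y K)
  (KH_closed : closed KH) (KH_convex : @convex_set R H KH)
  (i_injective : injective i) (i_dense : dense (range i))
  (preimage_KH : i @^-1` KH = K)
  (G_diff : forall x y : X, is_diff y (G x) (DyG x y))
  (gamma tau : R) (B : set H)
  (x : nat -> X) (lambda w : nat -> H) (rho : nat -> R)
  (alm : alm_sequences KH i G gamma tau B x lambda w rho)
  (F_bounded : bounded_operator F)
  (F_pseudomonotone : pseudomonotone F)
  (Phi_mosco : weakly_mosco_continuous (feasible_map C K G))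
  (G_concave : concave_wrt_recession KH i G)
  (dist_lsc : weak_seq_lsc
     (fun p : (X * X)%type => distance KH (i (G p.1 p.2))))
  (eps : nat -> dual X)
  (inexact : inexact_vi_steps C KH i F G DyG x w rho eps)
  (eps_cvg0 : eps @ \oo --> 0)
  (xbar : X) (x_xbar : weak_limit_point x xbar)
  (Phi_neq0 : feasible_map C K G xbar !=set0) :
  feasible_map C K G xbar xbar /\ qvi_solution C K F G xbar.
Proof.
have [phi [phi_inc phi_weak]] := x_xbar.
(* The subsequence starts at [phi 1 > 0]: the starting point of the method
   need not lie in [C], and every later iterate [x (n k).+1] is produced by step
   [n k]. *)
pose n k := (phi k.+1).-1.
have nS k : (n k).+1 = phi k.+1.
  by rewrite prednK// (leq_trans _ (increasing_seq_ge phi_inc k.+1)).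
have n_ge k : (k <= n k)%N by rewrite -ltnS nS increasing_seq_ge.
have n_infty : n @ \oo --> \oo.
  apply/cvgnyPge => N; near=> k; apply: leq_trans (n_ge k).
  by near: k; exact: nbhs_infty_ge.
have [rho_gt0 res_or_rho] := alm_residual_or_penalty alm.
have [Mw wM] : exists M, forall k, `|w k| <= M.
  have [M [Mreal BM]] := alm_B_bounded alm.
  by exists (M + 1) => k; apply: (BM (M + 1)); [rewrite ltrDl|exact: alm_w alm k].
have sol : qvi_solution C K F G xbar.
  apply: (@limit_point_solution _ _ _ _ C K KH i F G DyG
    C_closed C_convex KH_closed KH_convex preimage_KH G_diff F_bounded
    F_pseudomonotone Phi_mosco G_concave dist_lsc
    (fun k => x (n k).+1) (fun k => w (n k)) (fun k => rho (n k))
    (fun k => eps (n k).+1) xbar Mw) => //.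
  - by move=> k; exact: (inexact (n k)).1.
  - by move=> k; exact: (inexact (n k)).2.
  - by apply: (cvg_comp _ (fun k => eps k.+1) n_infty); rewrite cvg_shiftS.
  - move=> f; under eq_fun do rewrite nS.
    by have := phi_weak f; rewrite -cvg_shiftS.
  - by case: res_or_rho => h; [left|right]; exact: cvg_comp n_infty h.
by split=> //; exact: sol.1.
Unshelve. all: by end_near. Qed.
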